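(* Let $m\ge3$ be an integer, $r>0$, and let $P$ be the uniform distribution defined on the boundary of a regular $m$-sided polygon inscribed in the circle of radius $r$ with center $(0,0)$ in $\mathbb{R}^2$. Then, with respect to the conditional set consisting of all $m$ vertices of the polygon, the conditional quantization coefficient for $P$ exists as a finite positive number and equals $\frac13m^2r^2\sin^2\frac{\pi}{m}$, i.e., $$\lim_{n\to\infty}n^2(V_n(P)-V_\infty(P))=\frac13m^2r^2\sin^2\frac{\pi}{m}.$$
   Context: The uniform distribution $P$ on the boundary is arc length on the boundary divided by the perimeter $2mr\sin\frac{\pi}{m}$. Let $d$ be the Euclidean distance on $\mathbb{R}^2$ and let $\beta$ be the set of the $m$ vertices of the polygon. For $n\ge m$, the $n$th conditional (unconstrained) quantization error for $P$ with respect to the conditional set $\beta$ is $$V_n(P)=\inf_\alpha\Big\{\int\min_{a\in\alpha\cup\beta}d(x,a)^2\,dP(x) : \alpha\subseteq\mathbb{R}^2,\ 0\le\mathrm{card}(\alpha)\le n-m\Big\},$$ and $V_\infty(P)=\lim_{n\to\infty}V_n(P)$. For $\kappa>0$, the $\kappa$-dimensional conditional quantization coefficient is $\lim_{n\to\infty}n^{2/\kappa}(V_n(P)-V_\infty(P))$ if it exists; here $\kappa=1$. *)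

(* Defs.v *)
From HB Require Import structures.
From mathcomp Require Import all_boot all_order all_algebra finmap.
From mathcomp Require Import all_classical all_reals all_analysis.
From mathcomp Require Import ring lra.
Set Implicit Arguments.
Unset Strict Implicit.
Unset Printing Implicit Defensive.
Import Order.TTheory GRing.Theory Num.Theory.
Import numFieldNormedType.Exports.
Local Open Scope classical_set_scope.
Local Open Scope ring_scope.

(* The library norm on [R * R] is the max norm, hence this definition. *)
Definition eucl_dist (R : realType) (x y : R * R) : R :=
  Num.sqrt ((x.1 - y.1) ^+ 2 + (x.2 - y.2) ^+ 2).

Section conditional_quantization.
Context {R : realType}.
Variables (P : probability (R * R)%type R) (beta : {fset (R * R)}).
Local Open Scope ereal_scope.

(* The big operator runs over a finite set, with +oo as the minimum over the
   empty set. *)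
Definition quant_cost (alpha : {fset (R * R)}) : \bar R :=
  \int[P]_x \big[mine/+oo]_(a <- (alpha `|` beta)%fset)
    ((eucl_dist x a) ^+ 2)%:E.

(* Meaningful for [#|` beta| <= n]; for smaller [n] the truncated subtraction
   gives [alpha = fset0]. *)
Definition cond_quant_error (n : nat) : \bar R :=
  ereal_inf [set quant_cost alpha |
    alpha in [set alpha : {fset (R * R)} | (#|` alpha| <= n - #|` beta|)%N]].

Definition cond_quant_error_oo : \bar R := limn cond_quant_error.

(* [lim] is a default value on divergent sequences, so the convergence of the
   quantization errors is required explicitly. *)
Definition is_cond_quant_coef (kappa : R) (c : \bar R) : Prop :=
  cvgn cond_quant_error /\
  (n%:R `^ (2 / kappa))%:E * (cond_quant_error n - cond_quant_error_oo)
    @[n --> \oo] --> c.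

End conditional_quantization.

Section regular_polygon.
Context {R : realType}.
Variables (m : nat) (r theta : R).

(* [theta] is the polar angle of the vertex of index 0; the indexing is
   periodic, of period [m]. *)
Definition polygon_vertex (k : nat) : R * R :=
  (r * cos (theta + 2 * pi * k%:R / m%:R),
   r * sin (theta + 2 * pi * k%:R / m%:R)).

Definition polygon_vertices : {fset (R * R)} :=
  [fset polygon_vertex k | k in iota 0 m]%fset.

Definition polygon_side (k : nat) : R :=
  eucl_dist (polygon_vertex k) (polygon_vertex k.+1).

(* The parametrization by arc length, on [0, polygon_side k], of the side from
   [polygon_vertex k] to [polygon_vertex k.+1]. *)
Definition polygon_edge (k : nat) (t : R) : R * R :=
  let v := polygon_vertex k in
  let w := polygon_vertex k.+1 in
  (v.1 + t / polygon_side k * (w.1 - v.1),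
   v.2 + t / polygon_side k * (w.2 - v.2)).

(* The length of the part of the boundary that lies in [A]: two sides share at
   most one point, so the lengths of the parts of the sides add up. *)
Definition polygon_arclength (A : set (R * R)) : \bar R :=
  (\sum_(k < m) lebesgue_measure
     (`[0%R, polygon_side k] `&` polygon_edge k @^-1` A))%E.

Definition polygon_perimeter : R := 2 * m%:R * r * sin (pi / m%:R).

Definition polygon_unif (m_ge3 : (3 <= m)%N) (r_gt0 : 0 < r)
    (A : set (R * R)) : \bar R :=
  ((polygon_perimeter^-1)%:E * polygon_arclength A)%E.

Lemma eucl_dist_polygon_vertex (i j : nat) :
  0 <= r -> eucl_dist (polygon_vertex i) (polygon_vertex (i + j)) =
  2 * r * `|sin (pi * j%:R / m%:R)|.
Proof.
move=> r0; rewrite /eucl_dist /polygon_vertex /=.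
set a := theta + _; set b := theta + _.
have -> : pi * j%:R / m%:R = (b - a) / 2 :> R.
  by rewrite /a /b natrD; move: (m%:R^-1) => c; field.
set h := (b - a) / 2.
have -> : b = a + h + h by rewrite /h; lra.
rewrite -(ger0_norm (_ : 0 <= 2 * r)); last by rewrite mulr_ge0.
rewrite -normrM -sqrtr_sqr; congr Num.sqrt.
clearbody h; clear b; clearbody a; rewrite !(sinD, cosD).
have := cos2Dsin2 a; have := cos2Dsin2 h.
set ch := cos h; set sh := sin h; set ca := cos a; set sa := sin a.
move=> Hh Ha.
have Hx : ca - ((ca * ch - sa * sh) * ch - (sa * ch + ca * sh) * sh) =
    2 * sh * (ca * sh + sa * ch).
  rewrite [X in X - _ = _](_ : _ = ca * (ch ^+ 2 + sh ^+ 2)); last first.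
    by rewrite Hh mulr1.
  by ring.
have Hy : sa - ((sa * ch + ca * sh) * ch + (ca * ch - sa * sh) * sh) =
    2 * sh * (sa * sh - ca * ch).
  rewrite [X in X - _ = _](_ : _ = sa * (ch ^+ 2 + sh ^+ 2)); last first.
    by rewrite Hh mulr1.
  by ring.
rewrite -!mulrBr Hx Hy.
transitivity ((2 * r * sh) ^+ 2 * ((ca ^+ 2 + sa ^+ 2) * (ch ^+ 2 + sh ^+ 2))).
  by ring.
by rewrite Hh Ha !mulr1.
Qed.

Lemma sin_pi_div_gt0 : (3 <= m)%N -> 0 < sin (pi / m%:R) :> R.
Proof.
move=> m3; have m0 : 0 < m%:R :> R by rewrite ltr0n (leq_trans _ m3).
rewrite sin_gt0_pi// divr_gt0 ?pi_gt0//= ltr_pdivrMr//.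
by rewrite ltr_pMr ?pi_gt0// ltr1n (leq_trans _ m3).
Qed.

Lemma polygon_sideE (k : nat) : (3 <= m)%N -> 0 < r ->
  polygon_side k = 2 * r * sin (pi / m%:R).
Proof.
move=> m3 r0; rewrite /polygon_side -addn1 eucl_dist_polygon_vertex ?ltW// mulr1.
by rewrite ger0_norm// ltW// sin_pi_div_gt0.
Qed.

Lemma polygon_side_gt0 (k : nat) : (3 <= m)%N -> 0 < r -> 0 < polygon_side k.
Proof.
by move=> m3 r0; rewrite polygon_sideE// mulr_gt0 ?mulr_gt0// sin_pi_div_gt0.
Qed.

Lemma polygon_perimeter_gt0 : (3 <= m)%N -> 0 < r -> 0 < polygon_perimeter.
Proof.
move=> m3 r0; have := polygon_side_gt0 0 m3 r0; rewrite polygon_sideE// => s0.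
rewrite /polygon_perimeter.
rewrite (_ : _ * _ = m%:R * (2 * r * sin (pi / m%:R))); last by ring.
by rewrite mulr_gt0// ltr0n (leq_trans _ m3).
Qed.

Lemma card_polygon_vertices : (3 <= m)%N -> 0 < r -> #|` polygon_vertices| = m.
Proof.
move=> m3 r0; rewrite card_in_imfset /= ?undup_id ?iota_uniq ?size_iota//.
have m0 : 0 < m%:R :> R by rewrite ltr0n (leq_trans _ m3).
have dist_lt i j : (i < j < m)%N -> polygon_vertex i != polygon_vertex j.
  move=> /andP[ij jm]; apply/eqP => e.
  have := eucl_dist_polygon_vertex i (j - i) (ltW r0).
  rewrite subnKC; last exact: ltnW.
  rewrite e /eucl_dist !subrr expr0n/= addr0 sqrtr0 => /esym/eqP; apply/negP.
  have s0 : 0 < sin (pi * (j - i)%:R / m%:R) :> R.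
    rewrite sin_gt0_pi// divr_gt0 ?mulr_gt0 ?pi_gt0 ?ltr0n ?subn_gt0//=;
      last first.
      by rewrite (leq_trans _ m3).
    rewrite ltr_pdivrMr// ltr_pM2l ?pi_gt0// ltr_nat.
    exact: leq_ltn_trans (leq_subr _ _) jm.
  by rewrite gt_eqF// mulr_gt0 ?mulr_gt0// normr_gt0 gt_eqF.
move=> i j; rewrite !mem_iota !add0n /= => im jm /eqP e; apply/eqP.
apply: contraLR e; case: (ltngtP i j) => // h _; last rewrite eq_sym.
  by apply: dist_lt; rewrite h.
by apply: dist_lt; rewrite h.
Qed.

Lemma measurable_polygon_edge (k : nat) :
  measurable_fun [set: R] (polygon_edge k).
Proof.
by apply: measurable_fun_pair => /=;
  apply: measurable_realfun.measurable_funD => //;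
  do 2!apply: measurable_realfun.measurable_funM => //.
Qed.

Section polygon_unif_probability.
Variables (m_ge3 : (3 <= m)%N) (r_gt0 : 0 < r).
Local Notation mu := (polygon_unif m_ge3 r_gt0).

Let polygon_unif0 : mu set0 = 0%E.
Proof.
rewrite /polygon_unif /polygon_arclength big1 ?mule0// => k _.
by rewrite preimage_set0 setI0 measure0.
Qed.

Let polygon_unif_ge0 A : (0 <= mu A)%E.
Proof.
apply: mule_ge0; last exact: sume_ge0.
by rewrite lee_fin invr_ge0 ltW// polygon_perimeter_gt0.
Qed.

Let polygon_unif_sigma_additive : semi_sigma_additive mu.
Proof.
have p0 : 0 <= polygon_perimeter^-1.
  by rewrite invr_ge0 ltW// polygon_perimeter_gt0.
pose part k : {measure set (measurableTypeR R) -> \bar R} :=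
  mrestr lebesgue_measure (measurable_itv `[0, polygon_side k]).
have /choice[side sideE] k : exists nu : {measure set (R * R) -> \bar R},
    forall A, nu A = pushforward (part k) (polygon_edge k) A.
  unshelve eexists (pushforward (part k) (polygon_edge k)).
  + exact: measurable_polygon_edge.
  + by [].
pose nu : {measure set (R * R) -> \bar R} := mscale (NngNum p0) (msum side m).
suff -> : mu = nu by exact: measure_semi_sigma_additive.
apply/funext => A; rewrite /nu /mscale /msum /=; congr (_ * _)%E.
by apply: eq_bigr => k _; rewrite sideE /pushforward /part /mrestr setIC.
Qed.

HB.instance Definition _ := isMeasure.Build _ _ _ mu
  polygon_unif0 polygon_unif_ge0 polygon_unif_sigma_additive.

Let polygon_unif_setT : mu [set: R * R] = 1%E.
Proof.
rewrite /polygon_unif /polygon_arclength.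
under eq_bigr => k _.
  rewrite preimage_setT setIT lebesgue_measure_itv/= lte_fin.
  rewrite polygon_side_gt0// -EFinD subr0 polygon_sideE//.
  over.
rewrite sumEFin -EFinM sumr_const card_ord; congr EFin.
have := polygon_perimeter_gt0 m_ge3 r_gt0.
rewrite /polygon_perimeter => /lt0r_neq0 p0.
rewrite (_ : (2 * r * sin (pi / m%:R)) *+ m = 2 * m%:R * r * sin (pi / m%:R)).
  by rewrite mulVf.
by rewrite -[LHS]mulr_natl; ring.
Qed.

HB.instance Definition _ := Measure_isProbability.Build _ _ _ mu
  polygon_unif_setT.

End polygon_unif_probability.
End regular_polygon.

(* Main.v *)
Require Import Defs.
From mathcomp Require Import all_boot all_order all_algebra finmap.
From mathcomp Require Import all_classical all_reals all_analysis.
From mathcomp Require Import measurable_realfun ring lra.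
Import Order.TTheory GRing.Theory Num.Theory.
Import numFieldNormedType.Exports.
Local Open Scope classical_set_scope.
Local Open Scope ring_scope.

(* Let [s] be the side length and [L = m * s] the perimeter; the coefficient is
   [L ^+ 2 / 12], and the limit of the errors is 0.
   Upper bound: cut every side into [q = n %/ m] equal parts.
   Lower bound: for every finite [A] and every [T],
     [T ^+ 2 <= min_(a in A) |x - a|^2 + sum_(a in A) max(0, T^2 - |x - a|^2)].
   Integrate this for [T = L / (2n)] over the points of the boundary at distance
   at least [eps = O(1/n)] from the vertices.  A ball of radius [T] then meets
   this part of at most one side, on which [max(0, T^2 - |x - a|^2)] is at most
   a truncated parabola of integral [4/3 T^3].  This value of [T] maximizes
   [T^2 L - n (4/3 T^3)], which becomes [L^3 / (12 n^2)], and the parts of the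
   boundary near the vertices cost only [O(n^-3)]. *)

(** * Geometry of the regular polygon *)

Section euclidean_plane.
Context {R : realType}.
Implicit Types (x y a : R * R) (T t : R).

Lemma eucl_dist_sqr x y :
  eucl_dist x y ^+ 2 = (x.1 - y.1) ^+ 2 + (x.2 - y.2) ^+ 2.
Proof. by rewrite sqr_sqrtr// addr_ge0 ?sqr_ge0. Qed.

(** Cauchy-Schwarz for a unit vector, by Lagrange's identity: the defect is the square of the cross
    product. *)
Lemma eucl_dist_proj (u1 u2 : R) x y : u1 ^+ 2 + u2 ^+ 2 = 1 ->
  (u1 * (x.1 - y.1) + u2 * (x.2 - y.2)) ^+ 2 <= eucl_dist x y ^+ 2.
Proof.
move=> u; rewrite eucl_dist_sqr; set p := x.1 - y.1; set q := x.2 - y.2.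
rewrite -[leRHS]mulr1 -u -subr_ge0.
rewrite (_ : _ - _ = (u1 * q - u2 * p) ^+ 2) ?sqr_ge0//; ring.
Qed.

Lemma eucl_dist_proj_lt (u1 u2 : R) x y T : u1 ^+ 2 + u2 ^+ 2 = 1 -> 0 <= T ->
  eucl_dist x y ^+ 2 < T ^+ 2 ->
  `|u1 * (x.1 - y.1) + u2 * (x.2 - y.2)| < T.
Proof.
move=> u T0 /(le_lt_trans (eucl_dist_proj _ _ x y u)).
by rewrite -real_normK ?num_real// ltr_pXn2r ?nnegrE.
Qed.

End euclidean_plane.

Section regular_polygon_geometry.
Context {R : realType}.
Variables (m : nat) (r theta : R).
Hypotheses (m_ge3 : (3 <= m)%N) (r_gt0 : 0 < r).
Local Notation s := (2 * r * sin (pi / m%:R)).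
Local Notation edge := (polygon_edge m r theta).
Implicit Types (i j k d : nat) (t : R) (a : R * R).

Let m_gt0 : 0 < m%:R :> R. Proof. by rewrite ltr0n (leq_trans _ m_ge3). Qed.

Let s_gt0 : 0 < s.
Proof. by rewrite mulr_gt0 ?mulr_gt0// sin_pi_div_gt0. Qed.

(** The side length divides out, so that later computations on a side use only a unit direction
    [u]. *)
Lemma polygon_edge_line k : exists u : R * R, u.1 ^+ 2 + u.2 ^+ 2 = 1 /\
  forall t, edge k t = ((polygon_vertex m r theta k).1 + t * u.1,
                        (polygon_vertex m r theta k).2 + t * u.2).
Proof.
have s0 := polygon_side_gt0 theta k m_ge3 r_gt0.
set S := polygon_side m r theta k in s0 *.
set v := polygon_vertex m r theta k; set w := polygon_vertex m r theta k.+1.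
have HS : S ^+ 2 = (w.1 - v.1) ^+ 2 + (w.2 - v.2) ^+ 2.
  by rewrite /S /polygon_side eucl_dist_sqr -/v -/w -opprB sqrrN -(opprB v.2) sqrrN.
have E t : edge k t = (v.1 + t / S * (w.1 - v.1), v.2 + t / S * (w.2 - v.2)).
  by [].
clearbody v w S; exists ((w.1 - v.1) / S, (w.2 - v.2) / S); split => /=.
  by rewrite !expr_div_n -mulrDl -HS divff// expf_neq0// gt_eqF.
by move=> t; rewrite E; congr pair; ring.
Qed.

Lemma eucl_dist_polygon_edge k t t' :
  eucl_dist (edge k t) (edge k t') ^+ 2 = (t - t') ^+ 2.
Proof.
have [u [u1 e]] := polygon_edge_line k.
rewrite eucl_dist_sqr !e/= -[RHS]mulr1 -u1; ring.
Qed.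

(** Orthogonal projection to the line of the side does not increase distances; [t0] is the parameter
    of the foot of the perpendicular from [a], possibly outside the side. *)
Lemma eucl_dist_polygon_edge_ge k a :
  exists t0, forall t, (t - t0) ^+ 2 <= eucl_dist (edge k t) a ^+ 2.
Proof.
have [u [u1 e]] := polygon_edge_line k.
set v := polygon_vertex m r theta k in e.
exists (- (u.1 * (v.1 - a.1) + u.2 * (v.2 - a.2))) => t.
have := eucl_dist_proj _ _ (edge k t) a u1.
congr (_ <= _); rewrite e/= -[in RHS](mulr1 t) -u1; ring.
Qed.

Local Notation p := (pi / m%:R : R).

(** Signed distance to the line through side [i], positive at the center: [r * cos p] is the
    apothem, and the angle is that of the outward normal, which points to the midpoint of the
    side. *)
Let height i x : R := r * cos p -
  (cos (theta + p + 2 * pi * i%:R / m%:R) * x.1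
   + sin (theta + p + 2 * pi * i%:R / m%:R) * x.2).

Let height_edge i j t : height i (edge j t) =
  height i (polygon_vertex m r theta j) * (1 - t / s)
  + height i (polygon_vertex m r theta j.+1) * (t / s).
Proof. by rewrite /height /polygon_edge polygon_sideE//=; ring. Qed.

Let height_vertex i j :
  height i (polygon_vertex m r theta j) =
  r * (cos p - cos (2 * pi * j%:R / m%:R - 2 * pi * i%:R / m%:R - p)).
Proof.
rewrite /height /polygon_vertex/=.
rewrite mulrBr; congr (_ - _).
rewrite (_ : _ - _ - p =
  theta + 2 * pi * j%:R / m%:R - (theta + p + 2 * pi * i%:R / m%:R)); last first.
  by ring.
by rewrite [in RHS]cosB; ring.
Qed.

Let height_edge_self i t : height i (edge i t) = 0.
Proof.
rewrite height_edge !height_vertex subrr sub0r cosN subrr mulr0 mul0r add0r.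
rewrite -addn1 natrD (_ : _ - p = p) ?subrr ?mulr0 ?mul0r//.
by field; rewrite gt_eqF.
Qed.

Let sin_mulp_ge0 d : (d <= m)%N -> 0 <= sin (d%:R * p).
Proof.
move=> dm; rewrite sin_ge0_pi// mulr_ge0 ?divr_ge0 ?pi_ge0//=.
by rewrite mulrCA ler_piMr ?pi_ge0// ler_pdivrMr// mul1r ler_nat.
Qed.

Let cos_mulp_even d : cos (2 * d%:R * p) = 1 - 2 * sin (d%:R * p) ^+ 2.
Proof.
rewrite (_ : 2 * _ * _ = d%:R * p + d%:R * p); last by ring.
by rewrite cosD; have := cos2Dsin2 (d%:R * p); lra.
Qed.

(** This is cos(A - B) - cos(A + B) = 2 sin A sin B. Both sines are nonnegative for [d.+1 <= m], so
    no vertex lies below the line of a side. *)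
Let heightl d : cos p - cos (2 * d.+1%:R * p - p) =
  2 * sin (d%:R * p) * sin (d.+1%:R * p).
Proof.
rewrite (_ : 2 * _ * p - p = d%:R * p + d.+1%:R * p); last first.
  by rewrite -addn1 natrD; ring.
rewrite [X in cos X - _](_ : _ = d.+1%:R * p - d%:R * p); last first.
  by rewrite -addn1 natrD; ring.
by rewrite cosB cosD; ring.
Qed.

Let height_vertexD i d : height i (polygon_vertex m r theta (i + d)) =
  r * (cos p - cos (2 * d%:R * p - p)).
Proof.
by rewrite height_vertex natrD; congr (_ * (_ - cos _)); ring.
Qed.

Lemma cos_pi_div_gt0 : 0 < cos p.
Proof.
rewrite cos_gt0_pihalf//; apply/andP; split.
  by rewrite (@lt_trans _ _ 0) ?oppr_lt0 ?divr_gt0 ?pi_gt0.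
by rewrite ltr_pM2l ?pi_gt0// ltf_pV2 ?posrE// ltr_nat.
Qed.

(** The height is affine along a side and nonnegative at both ends. Both barycentric weights are at
    least [eps / s], so the height is at least [eps / s] times the sum of the two end heights. *)
Let height_edgeD i d t eps : (0 < d)%N -> (i + d < m)%N ->
  0 <= eps -> eps <= t <= s - eps ->
  (eps / s) * (4 * r * cos p * sin (d%:R * p) ^+ 2) <=
  height i (edge (i + d) t).
Proof.
move=> d0 idm e0 /andP[et ts]; have cp0 := cos_pi_div_gt0.
have dm : (d < m)%N by rewrite (leq_ltn_trans _ idm)// leq_addl.
rewrite height_edge -addnS !height_vertexD.
have h1 : 0 <= r * (cos p - cos (2 * d%:R * p - p)).
  case: d d0 {idm} dm => // d _ dm; have dm' := ltnW dm.
  by rewrite heightl !mulr_ge0 ?(ltW r_gt0) ?sin_mulp_ge0// ltnW.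
have h2 : 0 <= r * (cos p - cos (2 * d.+1%:R * p - p)).
  by rewrite heightl !mulr_ge0 ?(ltW r_gt0) ?sin_mulp_ge0// ltnW.
have -> : 4 * r * cos p * sin (d%:R * p) ^+ 2 =
  r * (cos p - cos (2 * d%:R * p - p)) + r * (cos p - cos (2 * d.+1%:R * p - p)).
  rewrite (_ : 2 * d.+1%:R * p - p = 2 * d%:R * p + p); last first.
    by rewrite -addn1 natrD; ring.
  by rewrite cosB cosD cos_mulp_even; ring.
rewrite mulrDr mulrC [X in _ + X]mulrC lerD// ler_wpM2l//.
  by rewrite lerBrDr -mulrDl ler_pdivrMr// mul1r; lra.
by rewrite ler_pM2r ?invr_gt0.
Qed.

(** By sin^2 A - sin^2 B = sin(A - B) sin(A + B), with both angles in [0, pi]. It makes the bound of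
    [height_edgeD] uniform in [d]. *)
Let sin_mulp_sqr_ge d : (0 < d < m)%N -> sin p ^+ 2 <= sin (d%:R * p) ^+ 2.
Proof.
case: d => // d /= dm; rewrite -subr_ge0.
have -> : sin (d.+1%:R * p) ^+ 2 - sin p ^+ 2 =
    sin (d%:R * p) * sin (d.+2%:R * p).
  rewrite (_ : d%:R * p = d.+1%:R * p - p); last by rewrite -[d.+1]addn1 natrD; ring.
  rewrite (_ : d.+2%:R * p = d.+1%:R * p + p); last by rewrite -[d.+2]addn1 natrD; ring.
  rewrite sinB sinD; set x := d.+1%:R * p.
  transitivity (sin x ^+ 2 * (cos p ^+ 2 + sin p ^+ 2) -
                (cos x ^+ 2 + sin x ^+ 2) * sin p ^+ 2); last by ring.
  by rewrite !cos2Dsin2; ring.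
by rewrite mulr_ge0 ?sin_mulp_ge0// ltnW// ltnW.
Qed.

(* Above the line through side [i], the points of any other side at distance at
   least [eps] from its ends have height at least a fixed multiple of [eps]. *)
Lemma polygon_edge_separation i j a T eps t t' : (i < j < m)%N ->
  0 <= eps -> 0 <= T -> 2 * T <= eps * (2 * cos p * sin p) ->
  eps <= t' <= s - eps ->
  eucl_dist (edge i t) a ^+ 2 < T ^+ 2 ->
  eucl_dist (edge j t') a ^+ 2 < T ^+ 2 -> False.
Proof.
move=> /andP[ij jm] e0 T0 Te ht'.
have d0 : (0 < j - i)%N by rewrite subn_gt0.
have ji : (i + (j - i))%N = j by rewrite subnKC// ltnW.
have := height_edgeD i (j - i) t' eps d0; rewrite ji => /(_ jm e0 ht') H.
have S : sin p ^+ 2 <= sin ((j - i)%:R * p) ^+ 2.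
  by rewrite sin_mulp_sqr_ge// d0 (leq_ltn_trans (leq_subr _ _)).
have {S}H : 2 * T <= height i (edge j t').
  apply: le_trans H; apply: (le_trans Te).
  have sp0 := @sin_pi_div_gt0 R _ m_ge3; have cp0 := cos_pi_div_gt0.
  rewrite (_ : eps * _ = eps / s * (4 * r * cos p * sin p ^+ 2)); last first.
    by field; rewrite !gt_eqF.
  apply: ler_wpM2l; first by rewrite divr_ge0// ltW.
  by rewrite ler_wpM2l// !mulr_ge0 ?ltW.
(* The normal of side [i] is a unit vector, so each of the two points differs from [a] in height by
   less than [T]. Their heights then differ by less than [2 * T], while the point of side [i] has
   height 0. *)
have N := cos2Dsin2 (theta + p + 2 * pi * i%:R / m%:R).
move=> /(eucl_dist_proj_lt _ _ _ _ _ N T0) + /(eucl_dist_proj_lt _ _ _ _ _ N T0).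
rewrite !ltr_norml => /andP[_ A] /andP[B _].
by have := height_edge_self i t; move: H; rewrite /height; lra.
Qed.

End regular_polygon_geometry.

(** * Integrals *)

Section integration.
Context {R : realType}.
Local Open Scope ereal_scope.
Local Notation mu := (@lebesgue_measure R).

(** The restricted measure agrees with [nu] on subsets of [D] and vanishes on subsets of the
    complement. *)
Lemma ge0_integral_mrestr d (T : measurableType d)
    (nu : {measure set T -> \bar R}) (D : set T) (mD : measurable D)
    (f : T -> \bar R) :
  measurable_fun [set: T] f -> (forall x, 0 <= f x) ->
  \int[mrestr nu mD]_x f x = \int[nu]_(x in D) f x.
Proof.
move=> mf f0; rewrite -(setUv D) ge0_integral_setU//; first last.
- by rewrite disj_set2E setICr.
- by rewrite setUv.
- exact: measurableC.
rewrite [X in _ + X](_ : _ = 0) ?adde0.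
  by apply: eq_measure_integral => A mA AD; rewrite /= /mrestr (setIidl AD).
rewrite (eq_measure_integral mzero) ?integral_measure_zero// => A mA AD.
by rewrite /= /mrestr (_ : A `&` D = set0) ?measure0//; apply/disjoints_subset.
Qed.

(** The uniform law is a rescaled finite sum of push-forwards of restricted Lebesgue measures, one
    for each side; the change of variables is made side by side. *)
Lemma integral_polygon_unif (m : nat) (r theta : R)
    (m_ge3 : (3 <= m)%N) (r_gt0 : (0 < r)%R) (F : R * R -> \bar R) :
  measurable_fun [set: R * R] F -> (forall x, 0 <= F x) ->
  \int[polygon_unif theta m_ge3 r_gt0]_x F x =
  ((polygon_perimeter m r)^-1)%:E * \sum_(k < m)
    \int[mu]_(t in `[0%R, polygon_side m r theta k])
      F (polygon_edge m r theta k t).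
Proof.
move=> mF F0.
have p0 : (0 <= (polygon_perimeter m r)^-1)%R.
  by rewrite invr_ge0 ltW// polygon_perimeter_gt0.
pose part k : {measure set (measurableTypeR R) -> \bar R} :=
  mrestr mu (measurable_itv `[0%R, polygon_side m r theta k]).
(* The push-forward is a measure only through the measurability of the parametrization; packing it
   this way lets [msum] add the sides. *)
have /choice[side sideE] k : exists nu : {measure set (R * R) -> \bar R},
    forall A, nu A = pushforward (part k) (polygon_edge m r theta k) A.
  unshelve eexists (pushforward (part k) (polygon_edge m r theta k)).
  + exact: measurable_polygon_edge.
  + by [].
pose nu : {measure set (R * R) -> \bar R} := mscale (NngNum p0) (msum side m).
rewrite (eq_measure_integral nu); last first.
  move=> A _ _; rewrite /= /polygon_unif /mscale /msum /=; congr (_ * _).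
  by apply: eq_bigr => k _; rewrite sideE /pushforward /part /= /mrestr setIC.
rewrite /nu ge0_integral_mscale//= ge0_integral_measure_sum//; congr (_ * _).
apply: eq_bigr => k _.
rewrite -(ge0_integral_mrestr _ _ mu _ (measurable_itv _)
   (F \o polygon_edge m r theta k)) //; last first.
- by move=> x; exact: F0.
- by apply: (measurableT_comp mF); exact: measurable_polygon_edge.
rewrite -(preimage_setT (polygon_edge m r theta k)).
have mE : measurable_fun [set: measurableTypeR R] (polygon_edge m r theta k).
  exact: measurable_polygon_edge.
rewrite -(ge0_integral_pushforward mE (part k))//.
by apply: eq_measure_integral => A _ _; rewrite sideE.
Qed.

Lemma measurable_eucl_dist_sqr (a : R * R) :
  measurable_fun [set: R * R] (fun x : R * R => (eucl_dist x a ^+ 2)%R).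
Proof.
rewrite (_ : (fun _ => _) = fun x => (x.1 - a.1) ^+ 2 + (x.2 - a.2) ^+ 2)%R.
  apply: measurable_funD;
  apply: measurable_funX;
  apply: measurable_funB => //.
by apply/funext => x; rewrite eucl_dist_sqr.
Qed.

Lemma measurable_quant_integrand (s : seq (R * R)) :
  measurable_fun [set: R * R] (fun x : R * R =>
    \big[mine/+oo]_(a <- s) ((eucl_dist x a) ^+ 2)%:E).
Proof.
elim: s => [|a s ih].
  by under eq_fun do rewrite big_nil; exact: measurable_cst.
under eq_fun do rewrite big_cons; apply: measurable_mine => //.
by apply/measurable_EFinP; exact: measurable_eucl_dist_sqr.
Qed.

Lemma quant_integrand_ge0 (s : seq (R * R)) x :
  0 <= \big[mine/+oo]_(a <- s) ((eucl_dist x a) ^+ 2)%:E.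
Proof.
apply: (big_ind (fun y => 0 <= y)) => // [|a _]; last by rewrite lee_fin sqr_ge0.
by move=> y z y0 z0; rewrite le_min y0.
Qed.

Lemma integral_sqr (a b t0 : R) : (a <= b)%R ->
  \int[mu]_(t in `[a, b]) ((t - t0) ^+ 2)%:E =
  (((b - t0) ^+ 3 - (a - t0) ^+ 3) / 3)%:E.
Proof.
(* The fundamental theorem of calculus is applied with [a < b]; a single point is treated apart. *)
rewrite le_eqVlt => /predU1P[->|ab].
  by rewrite set_itv1 integral_set1 subrr mul0r.
have D (t : R) :
    is_derive t (1%R : R) (fun t : R => (t - t0) ^+ 3 / 3)%R ((t - t0) ^+ 2)%R.
  apply: is_derive_eq; rewrite /GRing.scale/=; lra.
have cont (g : R -> R) x : derivable g x (1%R : R) -> {for x, continuous g}.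
  by move=> /derivable1_diffP/differentiable_continuous.
have C x : {for x, continuous (fun t : R => (t - t0) ^+ 3 / 3)%R}.
  by apply: cont; have [] := D x.
rewrite (@continuous_FTC2 R _ (fun t => (t - t0) ^+ 3 / 3)%R) //.
- by rewrite -EFinB -mulrBl.
- by apply: continuous_subspaceT => x; apply: cont.
- split.
  + by move=> x _; have [] := D x.
  + exact: cvg_at_right_filter (C a).
  + exact: cvg_at_left_filter (C b).
- by move=> x _; rewrite derive1E; have [_ ->] := D x.
Qed.

End integration.

Section interval_integrals.
Context {R : realType}.
Local Open Scope ereal_scope.
Local Notation mu := (@lebesgue_measure R).

Lemma integral_itv_cst (a b c : R) : (a <= b)%R ->
  \int[mu]_(t in `[a, b]) c%:E = (c * (b - a))%:E.
Proof.
move=> ab; rewrite integral_cst//= lebesgue_measure_itv/= lte_fin.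
move: ab; rewrite le_eqVlt => /predU1P[->|->]; last by rewrite EFinM EFinB.
by rewrite ltxx subrr mulr0 mule0.
Qed.

Lemma integral_truncated_sqr_le (a b t0 T : R) : (0 <= T)%R ->
  \int[mu]_(t in `[a, b]) (Num.max 0 (T ^+ 2 - (t - t0) ^+ 2))%:E
    <= (4 / 3 * T ^+ 3)%:E.
Proof.
move=> T0; pose g (t : R) : R := (Num.max 0 (T ^+ 2 - (t - t0) ^+ 2))%R.
have g0 t : 0 <= (g t)%:E by rewrite lee_fin le_max lexx.
have mg : measurable_fun [set: measurableTypeR R] (EFin \o g).
  apply/measurable_EFinP; apply: measurable_funTS; apply: measurable_maxr => //.
  by apply: measurable_funB => //; apply: measurable_funX; apply: measurable_funB.
have mgS D : measurable_fun D (EFin \o g) by exact: measurable_funTS.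
pose D : set R := `[(t0 - T)%R, (t0 + T)%R]%classic.
have mD : measurable (D : set (measurableTypeR R)) by exact: measurable_itv.
(* Enlarging the domain to the whole line removes [a] and [b]; the integrand vanishes outside
   [D]. *)
apply: (@le_trans _ _ (\int[mu]_t (g t)%:E)).
  by apply: ge0_subset_integral => // t _; exact: g0.
rewrite (_ : \int[mu]_t (g t)%:E = \int[mu]_(t in D) (g t)%:E); last first.
  rewrite [RHS]integral_mkcond; apply: eq_integral => t _.
  rewrite patchE; case: ifPn => // /negP tD; congr EFin; apply/max_idPl.
  rewrite subr_le0 -[leRHS]real_normK ?num_real//.
  rewrite ler_pXn2r ?nnegrE// leNgt; apply/negP => tT; apply: tD.
  rewrite inE /D/= in_itv/=; move: tT; rewrite ltr_norml => /andP[].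
  by move=> ? ?; apply/andP; split; lra.
have DD : (t0 - T <= t0 + T)%R by lra.
(* The square is added instead of subtracted, which keeps all integrands nonnegative; on [D] the sum
   is the constant [T ^+ 2]. The bound is then 2 T^3 - (2/3) T^3. *)
have : \int[mu]_(t in D) (g t)%:E + \int[mu]_(t in D) ((t - t0) ^+ 2)%:E
    <= (T ^+ 2 * ((t0 + T) - (t0 - T)))%:E.
  rewrite -integral_itv_cst// -ge0_integralD//; first last.
  - apply/measurable_EFinP; apply: measurable_funTS.
    by apply: measurable_funX; apply: measurable_funB.
  - by move=> t _; rewrite lee_fin sqr_ge0.
  - exact: mgS.
  apply: ge0_le_integral => //.
  - by move=> t _; rewrite adde_ge0// lee_fin sqr_ge0.
  - apply: emeasurable_funD; first exact: mgS.
    apply/measurable_EFinP; apply: measurable_funTS.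
    by apply: measurable_funX; apply: measurable_funB.
  move=> t; rewrite /D/= in_itv/= => /andP[t1 t2].
  rewrite -EFinD lee_fin /g; set x := (_ - (t - t0) ^+ 2)%R.
  have x0 : (0 <= x)%R by rewrite /x; nra.
  by rewrite (max_idPr x0) /x subrK.
rewrite integral_sqr// -leeBrDr// -EFinB => /le_trans; apply.
by rewrite lee_fin le_eqVlt; apply/orP; left; apply/eqP; field.
Qed.

(** Induction on the number of cells. The last cell loses its left end to make the union disjoint,
    and putting it back can only increase the integral. *)
Lemma integral_subdivision_le (f : R -> \bar R) (d C : R) (N : nat) :
  measurable_fun [set: measurableTypeR R] f -> (forall t, 0 <= f t) ->
  (0 <= d)%R ->
  (forall i, (i < N)%N ->
    \int[mu]_(t in `[(i%:R * d)%R, (i.+1%:R * d)%R]) f t <= C%:E) ->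
  \int[mu]_(t in `[0%R, (N%:R * d)%R]) f t <= (N%:R * C)%:E.
Proof.
move=> mf f0 d0; elim: N => [_|N ih H].
  by rewrite !mul0r set_itv1 integral_set1.
have h1 : (0 <= N%:R * d)%R by rewrite mulr_ge0.
have h2 : (N%:R * d <= N.+1%:R * d)%R by rewrite ler_wpM2r// ler_nat.
have E : `[0%R, (N.+1%:R * d)%R]%classic =
    (`[0%R, (N%:R * d)%R] `|` `](N%:R * d)%R, (N.+1%:R * d)%R])%classic :> set R.
  by rewrite -itv_bndbnd_setU// bnd_simp.
rewrite E ge0_integral_setU//; first last.
- rewrite disj_set2E; apply/eqP/seteqP; split => // t [] /=.
  rewrite !in_itv/= => /andP[_ t1] /andP[t2 _].
  by move: (le_lt_trans t1 t2); rewrite ltxx.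
- exact: measurable_funTS.
rewrite [in leRHS]mulrSr mulrDl mul1r EFinD leeD//.
  by apply: ih => i iN; apply: H; rewrite ltnW.
apply: le_trans (H N (ltnSn N)); apply: ge0_subset_integral => //.
- exact: measurable_funTS.
- by apply: subset_itvr; rewrite bnd_simp.
Qed.

End interval_integrals.

(** * Bounds on the quantization error *)

Section quantization_bounds.
Context {R : realType}.
Variables (m : nat) (r theta : R).
Hypotheses (m_ge3 : (3 <= m)%N) (r_gt0 : 0 < r).
Local Notation s := (2 * r * sin (pi / m%:R)).
Local Notation edge := (polygon_edge m r theta).
Local Notation mu := (@lebesgue_measure R).
Local Notation p := (pi / m%:R : R).
Local Notation P := (polygon_unif theta m_ge3 r_gt0).
Local Notation beta := (polygon_vertices m r theta).
Local Notation cost A x := (\big[mine/+oo%E]_(a <- A) ((eucl_dist x a) ^+ 2)%:E).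

Let m_gt0 : 0 < m%:R :> R. Proof. by rewrite ltr0n (leq_trans _ m_ge3). Qed.

Let s_gt0 : 0 < s.
Proof. by rewrite mulr_gt0 ?mulr_gt0// sin_pi_div_gt0. Qed.

Let measurable_edge k : measurable_fun [set: measurableTypeR R] (edge k).
Proof. exact: measurable_polygon_edge. Qed.

Local Open Scope ereal_scope.

Lemma quant_cost_polygon (alpha : {fset (R * R)}) :
  quant_cost P beta alpha = ((m%:R * s)^-1)%:E *
    \sum_(k < m) \int[mu]_(t in `[0%R, s])
      cost (alpha `|` beta)%fset (edge k t).
Proof.
rewrite /quant_cost integral_polygon_unif; last first.
- exact: quant_integrand_ge0.
- exact: measurable_quant_integrand.
congr (_%:E * _); first by rewrite /polygon_perimeter; congr (_^-1)%R; ring.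
by apply: eq_bigr => k _; rewrite polygon_sideE.
Qed.

(** The term of a nearest point already makes up the gap to [T ^+ 2], and the others are
    nonnegative; for empty [A] the minimum is [+oo]. The sum over [A] can then be integrated point
    by point. *)
Lemma truncated_quant_integrand_ge (A : seq (R * R)) (x : R * R) (T : R) :
  (T ^+ 2)%:E <= cost A x +
    \sum_(a <- A) (Num.max 0 (T ^+ 2 - eucl_dist x a ^+ 2))%R%:E.
Proof.
elim: A => [|a A ih]; first by rewrite !big_nil addye// leey.
rewrite !big_cons; set g := Num.max _ _; set S := \sum_(_ <- _) _ in ih *.
have S0 : 0 <= S by apply: sume_ge0 => b _; rewrite lee_fin le_max lexx.
have g0 : 0 <= g%:E by rewrite lee_fin le_max lexx.
rewrite minEle; case: ifPn => _.
  rewrite addeA -EFinD; apply: (le_trans _ (leeDl _ S0)); rewrite lee_fin.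
  by rewrite -lerBlDl le_max lexx orbT.
by rewrite addeCA; apply: le_trans ih _; exact: leeDr.
Qed.

(** At most one term of the sum is nonzero, by [polygon_edge_separation], so the bound for one line
    carries no factor [m]. *)
Lemma sum_integral_truncated_sqr_le (a : R * R) (T eps : R) :
  (0 <= T)%R -> (0 <= eps)%R -> (2 * T <= eps * (2 * cos p * sin p))%R ->
  \sum_(k < m) \int[mu]_(t in `[eps, (s - eps)%R])
      (Num.max 0 (T ^+ 2 - eucl_dist (edge k t) a ^+ 2))%R%:E
    <= (4 / 3 * T ^+ 3)%:E.
Proof.
move=> T0 e0 Te.
pose I k := \int[mu]_(t in `[eps, (s - eps)%R])
  (Num.max 0 (T ^+ 2 - eucl_dist (edge k t) a ^+ 2))%R%:E.
change (\sum_(k < m) I k <= (4 / 3 * T ^+ 3)%:E).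
have I0 k : ~ (exists2 t, (eps <= t <= s - eps)%R &
    (eucl_dist (edge k t) a ^+ 2 < T ^+ 2)%R) -> I k = 0.
  move=> H; apply: integral0_eq => t /=; rewrite in_itv/= => ht.
  congr EFin; apply/max_idPl; rewrite subr_le0 leNgt; apply/negP => h.
  by apply: H; exists t.
have Ile k : I k <= (4 / 3 * T ^+ 3)%:E.
  (* Replacing [a] by its foot on the line decreases distances, hence increases the truncated
     integrand. *)
  have [t0 ht0] := eucl_dist_polygon_edge_ge m r theta m_ge3 r_gt0 k a.
  apply: le_trans (integral_truncated_sqr_le eps (s - eps)%R t0 _ T0).
  apply: ge0_le_integral => //.
  - by move=> t _; rewrite lee_fin le_max lexx.
  - apply/measurable_EFinP; apply: measurable_funTS; apply: measurable_maxr => //.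
    apply: measurable_funB => //.
    exact: (measurableT_comp (measurable_eucl_dist_sqr a) (measurable_edge k)).
  - apply/measurable_EFinP; apply: measurable_funTS; apply: measurable_maxr => //.
    by apply: measurable_funB => //; apply: measurable_funX; apply: measurable_funB.
  - by move=> t _; rewrite lee_fin ge_max !le_max lexx/= [X in _ || X]lerB ?orbT.
have [[k [t ht hk]]|H] := pselect (exists k : 'I_m, exists2 t,
    (eps <= t <= s - eps)%R & (eucl_dist (edge k t) a ^+ 2 < T ^+ 2)%R); last first.
  rewrite big1 ?lee_fin ?mulr_ge0 ?exprn_ge0// => k _; apply: I0 => -[t t1 t2].
  by apply: H; exists k, t.
rewrite (bigD1 k)//= big1 ?adde0 // => j jk; apply: I0 => -[t' ht' hj].
have [kj|jk'|/val_inj jk'] := ltngtP k j; last by rewrite jk' eqxx in jk.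
- apply: (polygon_edge_separation m r theta m_ge3 r_gt0 k j a T eps t t') => //.
  by rewrite kj ltn_ord.
- apply: (polygon_edge_separation m r theta m_ge3 r_gt0 j k a T eps t' t) => //.
  by rewrite jk' ltn_ord.
Qed.

Lemma sum_integral_cost_ge (A : seq (R * R)) (T eps : R) :
  (0 <= T)%R -> (0 <= eps)%R -> (2 * T <= eps * (2 * cos p * sin p))%R ->
  (2 * eps <= s)%R ->
  (m%:R * (T ^+ 2 * (s - 2 * eps)))%:E <=
  \sum_(k < m) \int[mu]_(t in `[0%R, s]) cost A (edge k t) +
  ((size A)%:R * (4 / 3 * T ^+ 3))%:E.
Proof.
move=> T0 e0 Te es.
pose g k a (t : R) : R := (Num.max 0 (T ^+ 2 - eucl_dist (edge k t) a ^+ 2))%R.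
have g0 k a t : 0 <= (g k a t)%:E by rewrite lee_fin le_max lexx.
have mg k a D : measurable_fun (D : set (measurableTypeR R)) (EFin \o g k a).
  apply/measurable_EFinP; apply: measurable_funTS; apply: measurable_maxr => //.
  apply: measurable_funB => //.
  exact: (measurableT_comp (measurable_eucl_dist_sqr a) (measurable_edge k)).
have mc k D : measurable_fun (D : set (measurableTypeR R))
    (fun t => cost A (edge k t)).
  apply: measurable_funTS.
  exact: (measurableT_comp (measurable_quant_integrand A) (measurable_edge k)).
have c0 x : 0 <= cost A x by exact: quant_integrand_ge0.
apply: (@le_trans _ _ (\sum_(k < m)
    (\int[mu]_(t in `[eps, (s - eps)%R]) cost A (edge k t)
    + \sum_(a <- A) \int[mu]_(t in `[eps, (s - eps)%R]) (g k a t)%:E))).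
  rewrite (_ : (m%:R * _)%:E = \sum_(k < m) (T ^+ 2 * (s - 2 * eps))%:E); last first.
    by rewrite sumEFin sumr_const card_ord mulr_natl.
  apply: lee_sum => k _.
  rewrite -ge0_integral_sum//; last by move=> a; exact: mg.
  rewrite -ge0_integralD//; last 2 first.
  - by move=> t _; apply: sume_ge0.
  - by apply: emeasurable_sum => a; exact: mg.
  rewrite (_ : s - 2 * eps = s - eps - eps)%R; last by ring.
  rewrite -integral_itv_cst; last by lra.
  apply: ge0_le_integral => //.
  - by move=> t _; rewrite lee_fin sqr_ge0.
  - apply: emeasurable_funD => //.
    by apply: emeasurable_sum => a; exact: mg.
  - by move=> t _; exact: truncated_quant_integrand_ge.
rewrite big_split/=; apply: leeD.
  apply: lee_sum => k _; apply: ge0_subset_integral => //.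
  by move=> t /=; rewrite !in_itv/= => /andP[t1 t2]; apply/andP; split; lra.
(* Summing over the sides first makes each point of [A] count once, not once per side. *)
rewrite exchange_big/=.
have -> : ((size A)%:R * (4 / 3 * T ^+ 3))%:E = \sum_(a <- A) (4 / 3 * T ^+ 3)%:E.
  by rewrite sumEFin big_const_seq count_predT iter_addr_0 mulr_natl.
by apply: lee_sum => a _; exact: sum_integral_truncated_sqr_le.
Qed.

(** The index [k = m], outside the range defining [beta], occurs as the end of the last side; by
    periodicity it gives vertex 0. *)
Lemma polygon_vertex_in (k : nat) : (k <= m)%N -> polygon_vertex m r theta k \in beta.
Proof.
rewrite leq_eqVlt => /predU1P[->|km]; last first.
  by apply/imfsetP; exists k => //=; rewrite mem_iota.
apply/imfsetP; exists 0%N => /=; first by rewrite mem_iota/= (leq_trans _ m_ge3).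
rewrite /polygon_vertex mulr0 mul0r addr0 mulfK ?gt_eqF// mulr_natl.
by rewrite (cosD2pi theta) (sinD2pi theta).
Qed.

(* The end points of the sides are left out, as they belong to [beta]. *)
Definition polygon_subdivision (q : nat) : {fset (R * R)} :=
  [fset polygon_edge m r theta kj.1 (kj.2%:R * (s / q%:R))
     | kj in [seq (k, j) | k <- iota 0 m, j <- iota 1 q.-1]]%fset.

Lemma card_polygon_subdivision q : (#|` polygon_subdivision q| <= m * q.-1)%N.
Proof.
apply: leq_trans (leq_imfset_card _ _ _) _ => /=.
by apply: leq_trans (size_undup _) _; rewrite size_allpairs !size_iota.
Qed.

Lemma polygon_subdivision_in q k j : (0 < q)%N -> (k < m)%N -> (j <= q)%N ->
  edge k (j%:R * (s / q%:R)) \in (polygon_subdivision q `|` beta)%fset.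
Proof.
move=> q0 km; rewrite in_fsetU leq_eqVlt => /predU1P[->|jq].
  have -> : edge k (q%:R * (s / q%:R)) = polygon_vertex m r theta k.+1.
    rewrite mulrC divfK ?gt_eqF ?ltr0n// /polygon_edge polygon_sideE//.
    by rewrite divff ?gt_eqF// !mul1r !(addrC _ (_ - _)%R) !subrK; case: polygon_vertex.
  by rewrite polygon_vertex_in ?orbT.
case: j jq => [_|j jq].
  have -> : edge k (0%:R * (s / q%:R)) = polygon_vertex m r theta k.
    by rewrite /polygon_edge !mul0r !addr0; case: polygon_vertex.
  by rewrite polygon_vertex_in ?orbT// ltnW.
apply/orP; left; apply/imfsetP; exists (k, j.+1) => //=.
apply/allpairsP; exists (k, j.+1) => /=; split => //; rewrite mem_iota//=.
by rewrite add1n prednK.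
Qed.

(** The side is cut into [2 * q] half-cells of length [d = s / (2 * q)], each having a node at one
    end and so costing at most [d ^+ 3 / 3]. *)
Lemma integral_cost_subdivision_le q k : (0 < q)%N -> (k < m)%N ->
  \int[mu]_(t in `[0%R, s]) cost (polygon_subdivision q `|` beta)%fset (edge k t)
    <= (s ^+ 3 / (12 * q%:R ^+ 2))%:E.
Proof.
move=> q0 km; have q0' : (0 < q%:R :> R)%R by rewrite ltr0n.
set A := (_ `|` _)%fset; pose d := (s / q%:R / 2)%R.
have d0 : (0 <= d)%R by rewrite /d !divr_ge0// ltW.
have -> : s = ((q.*2)%:R * d)%R.
  by rewrite /d -muln2 natrM; field; rewrite gt_eqF.
have -> : ((q.*2%:R * d) ^+ 3 / (12 * q%:R ^+ 2) = q.*2%:R * (d ^+ 3 / 3))%R.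
  by rewrite -muln2 natrM; field; rewrite gt_eqF.
apply: integral_subdivision_le => //.
- exact: (measurableT_comp (measurable_quant_integrand A) (measurable_edge k)).
- by move=> t; exact: quant_integrand_ge0.
(* [c] is the node bounding half-cell [i]: its left end if [i] is even, its right end if [i] is
   odd. *)
move=> i iq; pose c := ((uphalf i)%:R * (s / q%:R))%R.
have cA : edge k c \in A.
  by apply: polygon_subdivision_in => //; rewrite leq_uphalf_double -ltnS ltnW.
apply: (@le_trans _ _ (\int[mu]_(t in `[(i%:R * d)%R, (i.+1%:R * d)%R])
    ((t - c) ^+ 2)%:E)).
  apply: ge0_le_integral => //.
  - by move=> t _; exact: quant_integrand_ge0.
  - apply: measurable_funTS.
    exact: (measurableT_comp (measurable_quant_integrand A) (measurable_edge k)).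
  - apply/measurable_EFinP; apply: measurable_funTS.
    by apply: measurable_funX; apply: measurable_funB.
  - move=> t _; rewrite -(eucl_dist_polygon_edge m r theta m_ge3 r_gt0 k).
    by rewrite (big_rem (edge k c)) //= ge_min lexx.
rewrite integral_sqr; last by rewrite ler_wpM2r// ler_nat.
rewrite lee_fin ler_pM2r ?invr_gt0//.
have cE : (c = (uphalf i).*2%:R * d)%R.
  by rewrite /c /d -muln2 natrM; field; rewrite gt_eqF.
have [oi|ei] := boolP (odd i).
  have ui : (uphalf i).*2 = i.+1.
    by rewrite uphalf_half oi doubleD -[in RHS](odd_double_half i) oi.
  by rewrite cE ui subrr -natr1 expr0n/= sub0r; lra.
have ui : (uphalf i).*2 = i by rewrite uphalf_half (negbTE ei) even_halfK.
by rewrite cE ui subrr -natr1 expr0n/= subr0; lra.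
Qed.

Lemma cond_quant_error_le n q : (0 < q)%N -> (q * m <= n)%N ->
  cond_quant_error P beta n <= (s ^+ 2 / (12 * q%:R ^+ 2))%:E.
Proof.
move=> q0 qn; have q0' : (0 < q%:R :> R)%R by rewrite ltr0n.
apply: (@le_trans _ _ (quant_cost P beta (polygon_subdivision q))).
  apply: ereal_inf_lbound; exists (polygon_subdivision q) => //=.
  (* The [m * (q - 1)] interior nodes fit in the budget [n - m] because [q * m <= n]. *)
  apply: leq_trans (card_polygon_subdivision q) _.
  rewrite card_polygon_vertices// -subn1 mulnBr muln1 mulnC.
  exact: leq_sub2r.
rewrite quant_cost_polygon.
apply: (@le_trans _ _ (((m%:R * s)^-1)%:E *
    \sum_(k < m) (s ^+ 3 / (12 * q%:R ^+ 2))%:E)).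
  apply: lee_wpmul2l; first by rewrite lee_fin invr_ge0 mulr_ge0// ltW.
  by apply: lee_sum => k _; exact: integral_cost_subdivision_le.
rewrite sumEFin sumr_const card_ord -EFinM lee_fin -[(_ *+ m)%R]mulr_natl.
rewrite le_eqVlt; apply/orP; left; apply/eqP.
have sp := @sin_pi_div_gt0 R _ m_ge3.
by field; rewrite mulr1 !gt_eqF.
Qed.

Lemma cond_quant_error_ge n (T eps : R) : (m <= n)%N ->
  (0 <= T)%R -> (0 <= eps)%R -> (2 * T <= eps * (2 * cos p * sin p))%R ->
  (2 * eps <= s)%R ->
  ((m%:R * s)^-1 * (m%:R * (T ^+ 2 * (s - 2 * eps)) - n%:R * (4 / 3 * T ^+ 3)))%:E
    <= cond_quant_error P beta n.
Proof.
move=> mn T0 e0 Te es; apply: le_ereal_inf_tmp => _ [alpha /= ha <-].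
rewrite quant_cost_polygon EFinM.
apply: lee_wpmul2l; first by rewrite lee_fin invr_ge0 mulr_ge0// ltW.
rewrite EFinB leeBlDr//.
apply: le_trans (sum_integral_cost_ge (alpha `|` beta)%fset _ _ T0 e0 Te es) _.
apply: leeD2l; rewrite lee_fin ler_wpM2r ?mulr_ge0 ?exprn_ge0// ler_nat.
(* [alpha] and [beta] together have at most [(n - m) + m] points, which is [n] since [m <= n]. *)
apply: leq_trans (leq_card_fsetU _ _) _.
rewrite card_polygon_vertices// in ha *.
by rewrite -[leqRHS](subnK mn) leq_add2r.
Qed.
End quantization_bounds.

(** * Asymptotics of the scaled errors *)

Section polygon_quantization_limit.
Context {R : realType}.
Variables (m : nat) (r theta : R).
Hypotheses (m_ge3 : (3 <= m)%N) (r_gt0 : 0 < r).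
Local Notation s := (2 * r * sin (pi / m%:R)).
Local Notation P := (polygon_unif theta m_ge3 r_gt0).
Local Notation beta := (polygon_vertices m r theta).
Local Notation V := (cond_quant_error P beta).
Local Notation c := (3^-1 * m%:R ^+ 2 * r ^+ 2 * sin (pi / m%:R) ^+ 2).

Let m_gt0 : 0 < m%:R :> R. Proof. by rewrite ltr0n (leq_trans _ m_ge3). Qed.

Let cE : c = (m%:R * s) ^+ 2 / 12. Proof. by move: (sin _) => S; field. Qed.

(** For [q = n %/ m], the remainder is less than [m], so [q * m >= n - m] and n / (q m) is at most 1
    / (1 - m / n). *)
Lemma scaled_cond_quant_error_le n : (m < n)%N ->
  ((n%:R ^+ 2)%:E * V n <= (c * (1 - m%:R * n%:R^-1)^-1 ^+ 2)%:E)%E.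
Proof.
move=> mn; have n0 : 0 < n%:R :> R by rewrite ltr0n (leq_trans _ mn).
have q0 : (0 < n %/ m)%N by rewrite divn_gt0 ?(ltnW mn)// (leq_trans _ m_ge3).
have mn0 : 0 < n%:R - m%:R :> R by rewrite subr_gt0 ltr_nat.
have nq : n%:R - m%:R <= (n %/ m)%:R * m%:R :> R.
  rewrite lerBlDr -natrM -natrD ler_nat {1}(divn_eq n m) leq_add2l ltnW//.
  by rewrite ltn_mod (leq_trans _ m_ge3).
have := cond_quant_error_le m r theta m_ge3 r_gt0 n (n %/ m)%N q0 (leq_trunc_div n m).
move=> /(lee_wpmul2l (_ : 0 <= (n%:R ^+ 2)%:E)%E) H.
apply: le_trans (H _) _; first by rewrite lee_fin sqr_ge0.
have q0' : 0 < (n %/ m)%:R :> R by rewrite ltr0n.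
rewrite -EFinM lee_fin cE.
have -> : (m%:R * s) ^+ 2 / 12 * (1 - m%:R * n%:R^-1)^-1 ^+ 2 =
    n%:R ^+ 2 * ((m%:R * s) ^+ 2 / 12 / (n%:R - m%:R) ^+ 2).
  move: s => S; field.
  by rewrite !gt_eqF.
rewrite ler_wpM2l ?sqr_ge0//.
have -> : s ^+ 2 / (12 * (n %/ m)%:R ^+ 2) =
    (m%:R * s) ^+ 2 / 12 / ((n %/ m)%:R * m%:R) ^+ 2.
  by move: s => S; field; rewrite !gt_eqF.
rewrite ler_wpM2l ?divr_ge0 ?sqr_ge0// lef_pV2 ?posrE ?exprn_gt0 ?mulr_gt0//.
by rewrite ler_pXn2r ?nnegrE ?mulr_ge0// ltW.
Qed.

Lemma scaled_cond_quant_error_ge : exists K : R, \forall n \near \oo,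
  ((c - K * n%:R^-1)%:E <= (n%:R ^+ 2)%:E * V n)%E.
Proof.
have sp := @sin_pi_div_gt0 R _ m_ge3.
have cp := @cos_pi_div_gt0 R _ m_ge3.
set C := cos _ in cp; have s0 : 0 < s by rewrite !mulr_gt0.
set S := sin _ in sp s0 *.
(* With [T = m * s / (2 * n)] and [eps = E / n], this value turns the separation condition into an
   equality. *)
pose E := m%:R * s / (2 * C * S).
have E0 : 0 < E by rewrite /E !(divr_gt0, mulr_gt0).
(* This is [n] times the scaled loss n^2 (m s)^-1 (2 m eps T^2) from trimming the sides. *)
exists ((m%:R * s) ^+ 2 * E / (2 * s)).
near=> n.
have mn : (m <= n)%N by near: n; exact: nbhs_infty_ge.
have n0 : 0 < n%:R :> R by rewrite ltr0n (leq_trans _ mn)// (leq_trans _ m_ge3).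
(* This is [2 * eps <= s]: the trimmed sides are nonempty. *)
have en : 2 * E / s <= n%:R by near: n; exact: nbhs_infty_ger.
have := cond_quant_error_ge m r theta m_ge3 r_gt0 n
  (m%:R * s / (2 * n%:R)) (E / n%:R) mn _ _ _ _.
move=> /(_ _ _ _ _)/(lee_wpmul2l (_ : 0 <= (n%:R ^+ 2)%:E)%E) H.
apply: le_trans (H _ _ _ _ _).
- rewrite -EFinM lee_fin cE -/S.
  rewrite le_eqVlt; apply/orP; left; apply/eqP; rewrite /E -/S.
  by field; rewrite !gt_eqF.
- by rewrite lee_fin sqr_ge0.
- by rewrite divr_ge0 ?mulr_ge0 ?ltW.
- by rewrite divr_ge0 ?ltW.
- rewrite -/C -/S le_eqVlt; apply/orP; left; apply/eqP; rewrite /E -/S.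
  by field; rewrite !gt_eqF.
- by rewrite mulrA ler_pdivrMr// [leRHS]mulrC -ler_pdivrMr.
Unshelve. all: by end_near. Qed.

Lemma cvg_natr_inv : (n%:R^-1 : R) @[n --> \oo] --> (0 : R).
Proof.
have n_gt0 : \forall n \near \oo, 0 < n%:R :> R.
  by near=> n; rewrite ltr0n; near: n; exact: nbhs_infty_gt.
exact/(gtr0_cvgV0 n_gt0)/cvgr_idn.
Unshelve. all: by end_near. Qed.

Lemma cvg_scaled_cond_quant_error : ((n%:R ^+ 2)%:E * V n)%E @[n --> \oo] --> c%:E.
Proof.
have [K HK] := scaled_cond_quant_error_ge.
have HU : \forall n \near \oo,
    ((n%:R ^+ 2)%:E * V n <= (c * (1 - m%:R * n%:R^-1)^-1 ^+ 2)%:E)%E.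
  by near=> n; apply: scaled_cond_quant_error_le; near: n; exact: nbhs_infty_gt.
have HKU : \forall n \near \oo,
    ((c - K * n%:R^-1)%:E <= (n%:R ^+ 2)%:E * V n <=
     (c * (1 - m%:R * n%:R^-1)^-1 ^+ 2)%:E)%E.
  by apply: filterS2 HK HU => n -> ->.
apply: (squeeze_cvge HKU).
- apply: cvg_EFin.
    by near=> n.
  have : (c - K * n%:R^-1 @[n --> \oo] --> c - K * 0).
    by apply: cvgB; [exact: cvg_cst | apply: cvgMr; exact: cvg_natr_inv].
  by rewrite mulr0 subr0.
- apply: cvg_EFin.
    by near=> n.
  have h1 : 1 - m%:R * n%:R^-1 @[n --> \oo] --> (1 - m%:R * 0 : R).
    by apply: cvgB; [exact: cvg_cst | apply: cvgMr; exact: cvg_natr_inv].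
  rewrite mulr0 subr0 in h1.
  have h2 : (1 - m%:R * n%:R^-1)^-1 @[n --> \oo] --> (1^-1 : R).
    by apply: cvgV => //; exact: oner_neq0.
  have : c * ((1 - m%:R * n%:R^-1)^-1 * (1 - m%:R * n%:R^-1)^-1) @[n --> \oo]
      --> c * (1^-1 * 1^-1).
    by apply: cvgMr; exact: cvgM.
  by rewrite invr1 !mulr1.
Unshelve. all: by end_near. Qed.

(** The scaled errors have a finite limit, and multiplying them back by n^-2 sends them to 0. *)
Lemma cvg_cond_quant_error : V n @[n --> \oo] --> 0%E.
Proof.
have H : ((n%:R^-1 ^+ 2)%:E * ((n%:R ^+ 2)%:E * V n))%E @[n --> \oo] -->
    (0%:E * c%:E)%E.
  apply: cvgeM => //; last exact: cvg_scaled_cond_quant_error.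
  apply: cvg_EFin; first by near=> n.
  rewrite -[0](mul0r 0); under eq_fun do rewrite expr2.
  by apply: cvgM; exact: cvg_natr_inv.
(* The two factors cancel only for [n > 0], hence an eventual equality. *)
rewrite mul0e in H; apply: cvg_trans H; apply: near_eq_cvg.
near=> n; rewrite muleA -EFinM -exprMn mulVf ?expr1n ?mul1e//.
by rewrite pnatr_eq0 -lt0n; near: n; exact: nbhs_infty_gt.
Unshelve. all: by end_near. Qed.

End polygon_quantization_limit.

Theorem theorem5p7 (R : realType) (m : nat) (r theta : R)
    (m_ge3 : (3 <= m)%N) (r_gt0 : 0 < r) :
  let P : probability (R * R)%type R := polygon_unif theta m_ge3 r_gt0 in
  let beta : {fset (R * R)} := polygon_vertices m r theta in
  let c : R := 3^-1 * m%:R ^+ 2 * r ^+ 2 * sin (pi / m%:R) ^+ 2 in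
  [/\ 0 < c,
      is_cond_quant_coef P beta 1 c%:E
    & ((n%:R ^+ 2)%:E *
         (cond_quant_error P beta n - cond_quant_error_oo P beta))%E
        @[n --> \oo] --> c%:E].
Proof.
move=> P beta c.
have V0 : cond_quant_error P beta n @[n --> \oo] --> 0%E.
  exact: cvg_cond_quant_error.
have Voo : cond_quant_error_oo P beta = 0%E by apply/cvg_lim.
have H : ((n%:R ^+ 2)%:E *
    (cond_quant_error P beta n - cond_quant_error_oo P beta))%E
    @[n --> \oo] --> c%:E.
  under eq_fun do rewrite Voo sube0.
  exact: cvg_scaled_cond_quant_error.
split => //.
  by rewrite !mulr_gt0 ?invr_gt0 ?exprn_gt0 ?sin_pi_div_gt0 ?ltr0n ?(leq_trans _ m_ge3).
split; first by apply/cvg_ex; exists 0%E.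
(* At [kappa = 1] the real power of exponent [2 / kappa] is the ordinary square. *)
by under eq_fun do rewrite divr1 powR_mulrn//.
Qed.
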